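(* Let $\Gamma$ be a doubly regular $(m,r)$-team semicomplete multipartite digraph with partite sets $V_1,\dots,V_m$ and parameters $t,\alpha_s,\beta_s,\gamma_s,\eta_s$ as in the context. Then $\Gamma$ is of one of the following three types: Type I: $\beta_1+\beta_2-\alpha_1-\alpha_2=r$ and $\Gamma$ is an $r$-coclique extension of a semicomplete digraph; Type II: $\beta_1+\beta_2-\alpha_1-\alpha_2=0$ and for each pair $(i,j)$ with $i\neq j$ the number $|A_j^+(x)|$ is the same value $c_{ij}$ for all $x\in V_i$, and $c_{ij}=c_{ji}=\frac{r-e_{ij}}{2}$, where $e_{ij}=|E_j(x)|$ for $x\in V_i$; Type III: $\beta_1+\beta_2-\alpha_1-\alpha_2=\frac{r}{2}$ and for each pair $(i,j)$ with $i\neq j$ one of the following holds: (a) $V_i\times V_j\subseteq E\Gamma$; (b) $V_i$ is partitioned into two nonempty sets $V_i=V_i'\cup V_i''$ with $(V_i'\times V_j)\cup(V_j\times V_i'')\subseteq A\vec\Gamma$, or the same holds with $i$ and $j$ interchanged; (c) $V_i=V_i'\cup V_i''$ and $V_j=V_j'\cup V_j''$ are partitions into nonempty sets with $(V_i'\times V_j')\cup(V_i''\times V_j'')\subseteq E\Gamma$ and $(V_i'\times V_j'')\cup(V_j'\times V_i'')\subseteq A\vec\Gamma$.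
   Context: A digraph has a finite vertex set $V\Gamma$ and arc set $A\Gamma$ of ordered pairs of distinct vertices; its underlying graph joins $x,y$ iff $(x,y)$ or $(y,x)$ is an arc. $K^m_r$ is the complete multipartite graph with $m$ parts each of size $r$; an $(m,r)$-team semicomplete multipartite digraph ($m,r\geq 2$) is a digraph whose underlying graph is $K^m_r$; its parts are the partite sets. A digraph is semicomplete if its underlying graph is complete. For digraphs $\Gamma,\Sigma$, the lexicographic product $\Gamma\circ\Sigma$ has vertex set $V\Gamma\times V\Sigma$ with $((u_1,u_2),(v_1,v_2))$ an arc iff $(u_1,v_1)\in A\Gamma$ or ($u_1=v_1$ and $(u_2,v_2)\in A\Sigma$); an $r$-coclique extension of $\Gamma$ is $\Gamma\circ\overline K_r$ with $\overline K_r$ the arcless digraph on $r$ vertices. Let $E\Gamma=\{(x,y):(x,y),(y,x)\in A\Gamma\}$, $\overline\Gamma=(V\Gamma,E\Gamma)$, $\vec\Gamma=(V\Gamma,A\Gamma\setminus E\Gamma)$, with adjacency matrices $A_0$, $A_1$ respectively. An $(m,r)$-team semicomplete multipartite digraph $\Gamma$ that is regular (all in- and out-degrees equal) is doubly regular if there exist integers $t,\alpha_s,\beta_s,\gamma_s,\eta_s$ ($s=0,1,2$) such that $A_iA_j=t\delta_{0,i+j}I+\alpha_{i+j}A_1+\beta_{i+j}A_1^{\top}+\gamma_{i+j}A_0+\eta_{i+j}(J-I-A_1-A_1^{\top}-A_0)$ for all $i,j\in\{0,1\}$ ($\delta$ Kronecker delta, $J$ all-ones matrix). For $x\in V_i$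 and $j\neq i$: $A_j^+(x)=\{y\in V_j:(x,y)\in A\vec\Gamma\}$ and $E_j(x)=\{y\in V_j:(x,y)\in E\Gamma\}$.
   Formalization: If every arc lies in EΓ (A_1=0, so Γ=K^m_r), the α_s, β_s are arbitrary and the claim fails for some choices; the formal theorem asserts it for the given parameters when A_1≠0, and for some valid choice of parameters in all cases. *)

(* Defs.v *)
From HB Require Import structures.
From mathcomp Require Import all_boot all_order all_algebra.

Set Implicit Arguments.
Unset Strict Implicit.
Unset Printing Implicit Defensive.

Import Order.TTheory GRing.Theory Num.Theory.
Local Open Scope ring_scope.

Record digraph := Digraph {
  vert :> finType;
  arcs : {set vert * vert};
  arcs_loopless : forall x, (x, x) \notin arcs
}.

Definition underlying_adj (G : digraph) : rel G :=
  [rel x y | ((x, y) \in arcs G) || ((y, x) \in arcs G)].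

Definition semicomplete (G : digraph) : Prop :=
  forall x y : G, x != y -> underlying_adj x y.

Definition digraph_iso (G H : digraph) : Prop :=
  exists2 f : G -> H, bijective f &
    forall x y, ((f x, f y) \in arcs H) = ((x, y) \in arcs G).

Definition lex_arcs (G H : digraph) : {set (G * H) * (G * H)} :=
  [set p : (G * H) * (G * H) |
    ((p.1.1, p.2.1) \in arcs G)
    || (p.1.1 == p.2.1) && ((p.1.2, p.2.2) \in arcs H)].

Lemma lex_arcs_loopless (G H : digraph) (x : G * H) :
  (x, x) \notin lex_arcs G H.
Proof.
by rewrite inE /= eqxx (negPf (arcs_loopless x.1)) (negPf (arcs_loopless x.2)).
Qed.

Definition lex_product (G H : digraph) : digraph :=
  Digraph (@lex_arcs_loopless G H).

Lemma set0_loopless (T : finType) (x : T) : (x, x) \notin (set0 : {set T * T}).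
Proof. by rewrite inE. Qed.

Definition arcless (r : nat) : digraph := Digraph (@set0_loopless 'I_r).

Definition coclique_extension (r : nat) (G S : digraph) : Prop :=
  digraph_iso G (lex_product S (arcless r)).

(* The underlying graph of G is the complete multipartite graph with m parts
   of size r, the family V being its partite sets. *)
Definition team_semicomplete_multipartite (m r : nat) (G : digraph)
    (V : 'I_m -> {set G}) : Prop :=
  [/\ (2 <= m)%N /\ (2 <= r)%N,
      forall i, #|V i| = r,
      forall x, exists! i, x \in V i
    & forall i j x y, x \in V i -> y \in V j -> underlying_adj x y = (i != j)].

Definition regular (G : digraph) : Prop :=
  exists k : nat, forall x : G,
    #|[set y | (x, y) \in arcs G]| = k /\ #|[set y | (y, x) \in arcs G]| = k.

(* [edges G] is the symmetric part of the arc set, [dir_arcs G] is the arc set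
   of the digraph obtained by deleting it. *)
Definition edges (G : digraph) : {set G * G} :=
  [set p : G * G | (p \in arcs G) && ((p.2, p.1) \in arcs G)].

Definition dir_arcs (G : digraph) : {set G * G} := arcs G :\: edges G.

Definition adj_mx (T : finType) (R : {set T * T}) : 'M[int]_#|T| :=
  \matrix_(i, j) ((enum_val i, enum_val j) \in R)%:R.

Definition part_mx (G : digraph) (i : 'I_2) : 'M[int]_#|G| :=
  if i == ord0 then adj_mx (edges G) else adj_mx (dir_arcs G).

(* Only the values of alpha, beta, gamma, eta at 0, 1, 2 are ever used. *)
Record params := Params {
  par_t : int;
  alpha : nat -> int;
  beta : nat -> int;
  gamma : nat -> int;
  eta : nat -> int
}.

Definition doubly_regular (G : digraph) (p : params) : Prop :=
  let A0 := adj_mx (edges G) in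
  let A1 := adj_mx (dir_arcs G) in
  regular G /\
  forall i j : 'I_2,
    let s := (i + j)%N in
    part_mx G i *m part_mx G j =
      (par_t p * (s == 0%N)%:R) *: 1%:M
      + alpha p s *: A1 + beta p s *: A1^T + gamma p s *: A0
      + eta p s *: (const_mx 1 - 1%:M - A1 - A1^T - A0).

Definition type_number (p : params) : int :=
  beta p 1%N + beta p 2%N - alpha p 1%N - alpha p 2%N.

Definition typeI (r : nat) (G : digraph) (p : params) : Prop :=
  type_number p = r%:Z /\
  exists2 S : digraph, semicomplete S & coclique_extension r G S.

Definition out_part (m : nat) (G : digraph) (V : 'I_m -> {set G}) (j : 'I_m)
    (x : G) : {set G} := [set y in V j | (x, y) \in dir_arcs G].

Definition edge_part (m : nat) (G : digraph) (V : 'I_m -> {set G}) (j : 'I_m)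
    (x : G) : {set G} := [set y in V j | (x, y) \in edges G].

Definition typeII (m r : nat) (G : digraph) (V : 'I_m -> {set G})
    (p : params) : Prop :=
  type_number p = 0 /\
  exists c e : 'I_m -> 'I_m -> nat, forall i j, i != j ->
    [/\ forall x, x \in V i -> #|out_part V j x| = c i j,
        forall x, x \in V i -> #|edge_part V j x| = e i j,
        c i j = c j i
      & (c i j)%:R = (r%:R - (e i j)%:R) / 2 :> rat].

Definition two_partition (T : finType) (W W1 W2 : {set T}) : Prop :=
  [/\ W1 != set0, W2 != set0, [disjoint W1 & W2] & W = W1 :|: W2].

Definition pair_b (G : digraph) (W U : {set G}) : Prop :=
  exists W1 W2 : {set G}, two_partition W W1 W2 /\
    setX W1 U :|: setX U W2 \subset dir_arcs G.

Definition pair_c (G : digraph) (W U : {set G}) : Prop :=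
  exists W1 W2 U1 U2 : {set G},
    [/\ two_partition W W1 W2, two_partition U U1 U2,
        setX W1 U1 :|: setX W2 U2 \subset edges G
      & setX W1 U2 :|: setX U1 W2 \subset dir_arcs G].

Definition typeIII (m r : nat) (G : digraph) (V : 'I_m -> {set G})
    (p : params) : Prop :=
  (type_number p)%:~R = r%:R / 2 :> rat /\
  forall i j, i != j ->
    [\/ setX (V i) (V j) \subset edges G,
        pair_b (V i) (V j) \/ pair_b (V j) (V i)
      | pair_c (V i) (V j)].

Definition one_of_three_types (m r : nat) (G : digraph) (V : 'I_m -> {set G})
    (p : params) : Prop :=
  [\/ typeI r G p, typeII r V p | typeIII r V p].

(* Main.v *)
(* Let A and E be the adjacency matrices of the directed arcs and of the edges,
   and C = J - A - A^T - E, the "same partite set" matrix. Regularity gives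
   A J = J A^T, and A A^T is symmetric, so A C - C A^T =
   (A^2 + A E)^T - (A^2 + A E) = tau (A - A^T), where
   tau = beta_1 + beta_2 - alpha_1 - alpha_2; similarly E C = C E. Entrywise, for x in V_i and y in V_j, the
   numbers |A_j^+(x)| and |A_i^+(y)| differ by tau, 0 or - tau according to
   whether x -> y, xy is an edge, or y -> x, and |E_j(x)| = |E_i(y)|.
   If tau = 0, double counting the arcs gives type II. If tau <> 0, these
   numbers determine all adjacencies between V_i and V_j: either they are
   constant on one of the two sets, which leaves the edges only, tau = r with
   all arcs in one direction, or (b); or they take the same two values on both
   sets, which is (c). *)
Require Import Defs.
From mathcomp Require Import all_boot all_order all_algebra.
From mathcomp Require Import zify ring.

Set Implicit Arguments.
Unset Strict Implicit.
Unset Printing Implicit Defensive.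

Import Order.TTheory GRing.Theory Num.Theory.
Local Open Scope ring_scope.

(** * Indicator sums and cardinalities over a finite type *)

Section FiniteCounting.
Variable T : finType.

Lemma sum_enum_val (F : T -> int) :
  \sum_(c < #|T|) F (enum_val c) = \sum_x F x.
Proof.
rewrite [RHS](reindex (@enum_val T T)) //=.
exact: onW_bij (enum_val_bij T).
Qed.

Lemma sum_indicator (P : pred T) :
  \sum_x (P x)%:R = #|[set x | P x]|%:R :> int.
Proof.
rewrite -sum1dep_card natr_sum [RHS]big_mkcond.
by apply: eq_bigr => x _; case: (P x).
Qed.

Lemma card_setId_full (U : {set T}) (P : pred T) :
  #|[set y in U | P y]| = #|U| <-> forall y, y \in U -> P y.
Proof.
have sub : [set y in U | P y] \subset U by apply/subsetP=> y; rewrite inE => /andP[].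
split=> [eqU y yU | allU]; last first.
  congr #|pred_of_set _|; apply/setP=> y; rewrite inE.
  by case yU: (y \in U) => //=; rewrite allU.
have /eqP/setP/(_ y) : [set y in U | P y] == U by rewrite eqEcard sub eqU leqnn.
by rewrite inE yU.
Qed.

Lemma card_setId_none (U : {set T}) (P : pred T) :
  (forall y, y \in U -> ~~ P y) -> #|[set y in U | P y]| = 0%N.
Proof.
move=> noU; apply/eqP; rewrite cards_eq0; apply/eqP/setP=> y; rewrite !inE.
by case yU: (y \in U) => //=; apply/negbTE/noU.
Qed.

Lemma setX_subP (W U : {set T}) (R : {set T * T}) :
  (forall x y, x \in W -> y \in U -> (x, y) \in R) -> setX W U \subset R.
Proof. by move=> H; apply/subsetP=> -[x y]; rewrite inE => /andP[/H]; apply. Qed.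

End FiniteCounting.

(** * Edges, non-symmetric arcs and the matrix identities they satisfy *)

Section Arcs.
Variable G : digraph.
Implicit Types (x y : G) (W U : {set G}).

Lemma in_edges x y :
  ((x, y) \in edges G) = ((x, y) \in arcs G) && ((y, x) \in arcs G).
Proof. by rewrite inE. Qed.

Lemma in_dir_arcs x y :
  ((x, y) \in dir_arcs G) = ((x, y) \in arcs G) && ((y, x) \notin arcs G).
Proof. by rewrite inE in_edges andbC; case: (_ \in _). Qed.

Lemma edges_sym x y : ((x, y) \in edges G) = ((y, x) \in edges G).
Proof. by rewrite !in_edges andbC. Qed.

Lemma dir_arcs_asym x y : (x, y) \in dir_arcs G -> (y, x) \notin dir_arcs G.
Proof. by rewrite !in_dir_arcs; do 2 case: (_ \in _). Qed.

Lemma edges_notin_dir x y : (x, y) \in edges G ->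
  ((x, y) \notin dir_arcs G) /\ ((y, x) \notin dir_arcs G).
Proof. by rewrite !in_dir_arcs in_edges; do 2 case: (_ \in _). Qed.

Lemma arc_indicator x y : ((x, y) \in arcs G)%:R =
  ((x, y) \in dir_arcs G)%:R + ((x, y) \in edges G)%:R :> int.
Proof.
by rewrite in_dir_arcs in_edges; case: ((x, y) \in _); case: ((y, x) \in _).
Qed.

Lemma tr_edges_mx : (adj_mx (edges G))^T = adj_mx (edges G).
Proof. by apply/matrixP => a b; rewrite !mxE edges_sym. Qed.

(** Both identities say that row sums are constant: each vertex has [par_t p] edges, hence
    [k - par_t p] outgoing non-symmetric arcs. *)
Lemma regular_adj_mx (p : params) : doubly_regular G p ->
  adj_mx (edges G) *m const_mx 1 = const_mx 1 *m adj_mx (edges G) /\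
  adj_mx (dir_arcs G) *m const_mx 1 = const_mx 1 *m (adj_mx (dir_arcs G))^T.
Proof.
case=> -[k regk] /(_ ord0 ord0); rewrite /part_mx /= => EE.
(* The diagonal entry of the square of the edge matrix counts the edges at [x]; on the other side
   only the identity term survives, as there are no loops. *)
have degE x : \sum_y ((x, y) \in edges G)%:R = par_t p.
  have /matrixP/(_ (enum_rank x) (enum_rank x)) := EE.
  rewrite !mxE !eqxx !enum_rankK in_dir_arcs in_edges.
  rewrite (negPf (arcs_loopless x)) /= !(mulr0, addr0, mulr1, subrr, subr0) => <-.
  rewrite -sum_enum_val; apply: eq_bigr => c _.
  rewrite !mxE !enum_rankK (edges_sym (enum_val c)).
  by case: (_ \in _).
have degA x : \sum_y ((x, y) \in dir_arcs G)%:R = k%:R - par_t p.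
  rewrite -(degE x) -(regk x).1 -sum_indicator -sumrB.
  by apply: eq_bigr => y _; rewrite arc_indicator addrK.
split; apply/matrixP => a b; rewrite !mxE.
- under eq_bigr do rewrite !mxE mulr1.
  under [RHS]eq_bigr do rewrite !mxE mul1r edges_sym.
  by rewrite (sum_enum_val (fun y => ((enum_val a, y) \in edges G)%:R))
    (sum_enum_val (fun y => ((enum_val b, y) \in edges G)%:R)) !degE.
- under eq_bigr do rewrite !mxE mulr1.
  under [RHS]eq_bigr do rewrite !mxE mul1r.
  by rewrite (sum_enum_val (fun y => ((enum_val a, y) \in dir_arcs G)%:R))
    (sum_enum_val (fun y => ((enum_val b, y) \in dir_arcs G)%:R)) !degA.
Qed.

Lemma doubly_regular_mx (p : params) : doubly_regular G p ->
  let E := adj_mx (edges G) in let A := adj_mx (dir_arcs G) in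
  let C := const_mx 1 - A - A^T - E in
  E *m C = C *m E /\ A *m C - C *m A^T = type_number p *: (A - A^T).
Proof.
move=> dreg; have [EJ AJ] := regular_adj_mx dreg.
case: dreg => _ dreg; have Et := tr_edges_mx.
have := dreg ord0 ord_max; have := dreg ord_max ord0.
have := dreg ord_max ord_max; rewrite /part_mx /= !addn0 add0n /=.
move: Et EJ AJ; set E := adj_mx _; set A := adj_mx _.
clearbody E A; move=> Et EJ AJ; rewrite mulr0 scale0r !add0r => AA AE EA.
have AtE : A^T *m E = (E *m A)^T by rewrite trmx_mul Et.
have EAt : E *m A^T = (A *m E)^T by rewrite trmx_mul Et.
split.
  rewrite !(mulmxBl, mulmxBr) EJ AtE EAt AE EA.
  by rewrite -!addrA; congr (_ + _); rewrite !addrA.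
have AtAt : A^T *m A^T = (A *m A)^T by rewrite trmx_mul.
rewrite !(mulmxBl, mulmxBr) AJ EAt AtAt AE AA.
(* These products cancel, so they are kept as opaque matrices when passing to entries. *)
move: (A *m A^T) (const_mx 1 *m A^T) => X Y.
have Eab a b : E a b = E b a by rewrite -{1}Et mxE.
apply/matrixP => a b; rewrite !mxE (Eab b a) (eq_sym b a) /type_number.
ring.
Qed.

Definition outn U x : nat := #|[set y in U | (x, y) \in dir_arcs G]|.
Definition edgen U x : nat := #|[set y in U | (x, y) \in edges G]|.

Lemma card_adj_split U x : (forall y, y \in U -> underlying_adj x y) ->
  #|U| = (outn U x + edgen U x + #|[set y in U | (y, x) \in dir_arcs G]|)%N.
Proof.
move=> adj; rewrite /outn /edgen -!sum1_card.
rewrite ![\sum_(_ in [set _ in _ | _]) _](big_mkcond) [LHS]big_mkcond -!big_split.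
apply: eq_bigr => y _; rewrite !inE /=; case yU: (y \in U) => //=.
by have := adj _ yU; rewrite /underlying_adj /=; do 2 case: (_ \in arcs G).
Qed.

Lemma dir_arcs_double_count W U :
  (\sum_(x in W) #|[set y in U | (y, x) \in dir_arcs G]| =
   \sum_(y in U) outn W y)%N.
Proof.
have E (S : {set G}) (P : pred G) :
    (#|[set y in S | P y]| = \sum_(y in S) P y)%N.
  rewrite -sum1dep_card big_mkcondr; apply: eq_bigr => y _.
  by case: (P y).
under eq_bigr do rewrite E; under [RHS]eq_bigr do rewrite /outn E.
by rewrite exchange_big.
Qed.

End Arcs.

(** * Classification of the adjacencies between two partite sets *)

Section Pair.
Variables (G : digraph) (tau : int) (r : nat).
Implicit Types (x y : G) (W U : {set G}).

(** The entrywise form of the two matrix identities, for [W] and [U] two distinct partite sets. The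
    classification of the pair relies on nothing else. *)
Definition balanced_pair W U : Prop :=
  [/\ #|W| = r, #|U| = r,
      forall x y, x \in W -> y \in U -> underlying_adj x y,
      forall x y, x \in W -> y \in U ->
        (outn U x)%:Z - (outn W y)%:Z =
        tau * (((x, y) \in dir_arcs G)%:R - ((y, x) \in dir_arcs G)%:R)
    & forall x y, x \in W -> y \in U -> edgen U x = edgen W y].

Lemma balanced_pair_sym W U : balanced_pair W U -> balanced_pair U W.
Proof.
case=> cW cU adj diff ed; split=> // x y xU yW.
- by have := adj _ _ yW xU; rewrite /underlying_adj /= orbC.
- by have := diff _ _ yW xU => H; rewrite -opprB H -mulrN opprB.
- by rewrite (ed y x).
Qed.

Lemma balanced_pair_cases W U x y : balanced_pair W U -> x \in W -> y \in U ->
  [\/ (x, y) \in dir_arcs G /\ (outn U x)%:Z - (outn W y)%:Z = tau,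
      (x, y) \in edges G /\ (outn U x)%:Z - (outn W y)%:Z = 0
    | (y, x) \in dir_arcs G /\ (outn U x)%:Z - (outn W y)%:Z = - tau].
Proof.
case=> _ _ adj diff _ xW yU; have := adj _ _ xW yU; have := diff _ _ xW yU.
move=> ->; rewrite /underlying_adj /= !in_dir_arcs in_edges.
case: ((x, y) \in _); case: ((y, x) \in _) => //= _.
- by constructor 2; rewrite subrr mulr0.
- by constructor 1; rewrite subr0 mulr1.
- by constructor 3; rewrite sub0r mulrN1.
Qed.

(** The last two alternatives fix [tau] and so separate type I from type III; the first leaves [tau]
    free. Doubling [tau] avoids a division in [int]. *)
Definition pair_classified W U : Prop :=
  [\/ setX W U \subset edges G,
      tau = r%:Z /\
        (setX W U \subset dir_arcs G \/ setX U W \subset dir_arcs G)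
    | tau *+ 2 = r%:Z /\ [\/ pair_b W U, pair_b U W | pair_c W U]].

Hypotheses (r_gt0 : (0 < r)%N) (tau_neq0 : tau != 0).

(** For nonzero [tau] the differences [tau], 0 and [- tau] are distinct, so the two out-counts
    determine the adjacency. *)
Lemma balanced_pair_edge W U x y : balanced_pair W U -> x \in W -> y \in U ->
  outn U x = outn W y -> (x, y) \in edges G.
Proof.
move=> bal xW yU e; case: (balanced_pair_cases bal xW yU) => -[] // _ H;
by move: tau_neq0; clear -H e; lia.
Qed.

Lemma balanced_pair_dir W U x y : balanced_pair W U -> x \in W -> y \in U ->
  (outn U x)%:Z = (outn W y)%:Z + tau -> (x, y) \in dir_arcs G.
Proof.
move=> bal xW yU e; case: (balanced_pair_cases bal xW yU) => -[] // _ H;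
by move: tau_neq0; clear -H e; lia.
Qed.

(** Here the adjacency of [x] and [y] depends on [y] alone. One edge therefore joins some [y0] to
    all of [W], and equality of edge counts spreads this to all pairs. Without edges, each [y]
    either dominates [W] or is dominated by it, and the kinds of [y] that occur give the remaining
    cases. *)
Lemma balanced_pair_const W U (s : nat) : balanced_pair W U ->
  (forall x, x \in W -> outn U x = s) -> pair_classified W U.
Proof.
move=> bal cst; have cases := balanced_pair_cases bal.
case: (bal) => cW cU adj diff ed.
have [x0 x0W] : exists x, x \in W by apply/set0Pn; rewrite -cards_eq0 cW -lt0n.
have [/existsP[y0 /andP[y0U e0]]|noE] :=
    boolP [exists y, (y \in U) && ((x0, y) \in edges G)].
  constructor 1; apply: setX_subP => x y xW yU.
  have e0' x' : x' \in W -> (y0, x') \in edges G.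
    move=> x'W; rewrite edges_sym; have [n1 n2] := edges_notin_dir e0.
    apply: (balanced_pair_edge bal) => //; rewrite (cst _ x'W) -(cst _ x0W).
    case: (cases _ _ x0W y0U) => -[h]; [by rewrite h in n1 | | by rewrite h in n2].
    by move/eqP; rewrite subr_eq0 => /eqP[].
  have full : edgen U x = r by rewrite (ed _ _ xW y0U) -cW; apply/card_setId_full.
  by move: y yU; apply/card_setId_full; rewrite cU.
have dich y : y \in U ->
    (forall x, x \in W -> (x, y) \in dir_arcs G) /\ s%:Z - (outn W y)%:Z = tau \/
    (forall x, x \in W -> (y, x) \in dir_arcs G) /\ s%:Z - (outn W y)%:Z = - tau.
  move=> yU; case: (cases _ _ x0W yU) => -[h]; rewrite cst // => eqt.
  - left; split=> // x xW; apply: (balanced_pair_dir bal) => //.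
    by rewrite cst // -eqt subrKC.
  - by case/negP: noE; apply/existsP; exists y; rewrite yU.
  - right; split=> // x xW; apply: (balanced_pair_dir (balanced_pair_sym bal)) => //.
    by rewrite cst // -[tau]opprK -eqt opprB subrKC.
have outr y : y \in U -> (forall x, x \in W -> (y, x) \in dir_arcs G) -> outn W y = r.
  by move=> yU h; rewrite -cW; apply/card_setId_full.
have out0 y : y \in U -> (forall x, x \in W -> (x, y) \in dir_arcs G) -> outn W y = 0%N.
  by move=> yU h; apply: card_setId_none => x xW; apply/dir_arcs_asym/h.
(* [U1] dominates [W] and forces [r = s + tau]; [U2] is dominated by [W] and forces [s = tau]. *)
pose U1 := [set y in U | (y, x0) \in dir_arcs G].
pose U2 := [set y in U | (x0, y) \in dir_arcs G].
have inU1 y : (y \in U1) = (y \in U) && ((y, x0) \in dir_arcs G) by rewrite inE.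
have inU2 y : (y \in U2) = (y \in U) && ((x0, y) \in dir_arcs G) by rewrite inE.
have U1P y : y \in U1 -> (forall x, x \in W -> (y, x) \in dir_arcs G) /\ r%:Z = s%:Z + tau.
  rewrite inE => /andP[yU yx0]; case: (dich y yU) => -[h eqt].
    by have := dir_arcs_asym yx0; rewrite h.
  by split=> //; have := outr _ yU h; lia.
have U2P y : y \in U2 -> (forall x, x \in W -> (x, y) \in dir_arcs G) /\ s%:Z = tau.
  rewrite inE => /andP[yU yx0]; case: (dich y yU) => -[h eqt].
    by split=> //; have := out0 _ yU h; lia.
  by have := dir_arcs_asym yx0; rewrite h.
have U12 y : y \in U -> (y \in U1) || (y \in U2).
  by move=> yU; rewrite inU1 inU2 yU /=; case: (dich y yU) => -[h _]; rewrite h ?orbT.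
have cU2 : #|U2| = s by rewrite -(cst x0).
have [U1_0|U1n] := eqVneq U1 set0.
  have U2U y : y \in U -> y \in U2 by move/U12; rewrite U1_0 in_set0.
  constructor 2; split; last first.
    by left; apply: setX_subP => x y xW /U2U /U2P[h _]; apply: h.
  (* [x0] dominates all of [U], so its out-count is [r]. *)
  have sr : s = r.
    by rewrite -cU -(cst x0 x0W); apply/card_setId_full => y /U2U; rewrite inE => /andP[].
  have [y yU2] : exists y, y \in U2 by apply/set0Pn; rewrite -cards_eq0 cU2 sr -lt0n.
  by have [_ <-] := U2P _ yU2; rewrite sr.
have [y1 y1U] := set0Pn _ U1n; have [_ eq1] := U1P _ y1U.
have [U2_0|U2n] := eqVneq U2 set0.
  have U1U y : y \in U -> y \in U1 by move/U12; rewrite U2_0 in_set0 orbF.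
  constructor 2; split.
    (* Here [s], the size of [U2], is 0, so [r = s + tau] reads [r = tau]. *)
    by move: cU2 eq1; rewrite U2_0 cards0; lia.
  by right; apply: setX_subP => x y /U1U /U1P[h _]; apply: h.
have [y2 y2U] := set0Pn _ U2n; have [_ eq2] := U2P _ y2U.
constructor 3; split; first by lia.
constructor 2; exists U1, U2; split.
  split=> //.
    rewrite -setI_eq0; apply/eqP/setP=> y; rewrite in_setI in_set0 inU1 inU2.
    case h: ((y, x0) \in dir_arcs G); last by rewrite !andbF.
    by rewrite (negPf (dir_arcs_asym h)) !andbF.
  apply/setP=> y; rewrite in_setU; apply/idP/idP => [/U12 //|].
  by rewrite inU1 inU2 => /orP[] /andP[].
rewrite subUset; apply/andP; split; apply: setX_subP => x y.
  by move=> /U1P[h _]; apply: h.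
by move=> xW /U2P[h _]; apply: h.
Qed.

Definition near_tau (a b : int) : Prop :=
  [\/ a - b = tau, a - b = 0 | a - b = - tau].

Lemma near_tauC a b : near_tau a b -> near_tau b a.
Proof.
by case=> h; [constructor 3 | constructor 2 | constructor 1];
  rewrite -opprB h ?oppr0 ?opprK.
Qed.

Lemma balanced_pair_near W U x y : balanced_pair W U -> x \in W -> y \in U ->
  near_tau (outn U x)%:Z (outn W y)%:Z.
Proof.
rewrite /near_tau => bal xW yU; case: (balanced_pair_cases bal xW yU) => -[_ ->];
by [constructor 1 | constructor 2 | constructor 3].
Qed.

(** The difference [a - s] lies both in {[tau], 0, [- tau]} and in {2 [tau], [tau], 0}. Two known
    levels on one side thus confine every out-count on the other. *)
Lemma near_tau_two_levels s a :
  near_tau a s -> near_tau a (s + tau) -> a = s \/ a = s + tau.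
Proof.
move=> h1 h2; move: tau_neq0.
by case: h1 => h1; case: h2 => h2; clear -h1 h2; lia.
Qed.

(* Four values, two per side and distinct on each side, whose cross differences
   lie in [{0, tau, - tau}] form the same pair [{s, s + tau}] on both sides. *)
Lemma two_level_values (a1 a2 b1 b2 : int) :
    near_tau a1 b1 -> near_tau a1 b2 -> near_tau a2 b1 -> near_tau a2 b2 ->
    a1 != a2 -> b1 != b2 ->
  exists s, (a1 = s /\ a2 = s + tau \/ a2 = s /\ a1 = s + tau) /\
            (b1 = s /\ b2 = s + tau \/ b2 = s /\ b1 = s + tau).
Proof.
move=> n11 n12 n21 n22 na nb.
(* If [b1] and [b2] differed by 2 [tau], only their midpoint would be near both, forcing [a1 = a2].
   So they differ by [tau], and only [b1] and [b2] themselves are near both. *)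
have [d|d] : a2 - a1 = tau \/ a1 - a2 = tau.
- case: n11 => ?; case: n12 => ?; case: n21 => ?; case: n22 => ?;
  by move: tau_neq0; lia.
- exists a1; split; first by lia.
  case: n11 => ?; case: n12 => ?; case: n21 => ?; case: n22 => ?;
  by move: tau_neq0; lia.
- exists a2; split; first by lia.
  case: n11 => ?; case: n12 => ?; case: n21 => ?; case: n22 => ?;
  by move: tau_neq0; lia.
Qed.

Lemma balanced_pair_levels W U (x1 x2 y1 y2 : G) : balanced_pair W U ->
    x1 \in W -> x2 \in W -> y1 \in U -> y2 \in U ->
    outn U x1 != outn U x2 -> outn W y1 != outn W y2 ->
  exists (s : int) (xl xh yl yh : G),
    [/\ xl \in W /\ xh \in W, yl \in U /\ yh \in U,
        (outn U xl)%:Z = s /\ (outn U xh)%:Z = s + tau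
      & (outn W yl)%:Z = s /\ (outn W yh)%:Z = s + tau].
Proof.
move=> bal x1W x2W y1U y2U nx ny.
have near := balanced_pair_near bal.
have [||s [hx hy]] := two_level_values (near _ _ x1W y1U) (near _ _ x1W y2U)
  (near _ _ x2W y1U) (near _ _ x2W y2U); [lia | lia |].
exists s.
have [xl [xh [Wx Ex]]] : exists xl xh, (xl \in W /\ xh \in W) /\
    ((outn U xl)%:Z = s /\ (outn U xh)%:Z = s + tau).
  by case: hx => h; [exists x1, x2 | exists x2, x1].
have [yl [yh [Uy Ey]]] : exists yl yh, (yl \in U /\ yh \in U) /\
    ((outn W yl)%:Z = s /\ (outn W yh)%:Z = s + tau).
  by case: hy => h; [exists y1, y2 | exists y2, y1].
by exists xl, xh, yl, yh.
Qed.

(** All out-counts on both sides are [s] or [s + tau]. Equal levels give edges, and unequal levels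
    an arc from level [s + tau] to level [s]; the level sets are the partitions of case (c). *)
Lemma balanced_pair_nonconst W U (x1 x2 y1 y2 : G) : balanced_pair W U ->
    x1 \in W -> x2 \in W -> y1 \in U -> y2 \in U ->
    outn U x1 != outn U x2 -> outn W y1 != outn W y2 ->
  tau *+ 2 = r%:Z /\ pair_c W U.
Proof.
move=> bal x1W x2W y1U y2U nx ny.
have [s [xl [xh [yl [yh [[xlW xhW] [ylU yhU] [exl exh] [eyl eyh]]]]]]] :=
  balanced_pair_levels bal x1W x2W y1U y2U nx ny.
have cases := balanced_pair_cases bal; case: (bal) => cW cU adj diff ed.
have Wval x : x \in W -> (outn U x)%:Z = s \/ (outn U x)%:Z = s + tau.
  move=> xW; apply: near_tau_two_levels; rewrite -?eyh -?eyl;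
  exact: balanced_pair_near.
have Uval y : y \in U -> (outn W y)%:Z = s \/ (outn W y)%:Z = s + tau.
  move=> yU; apply: near_tau_two_levels; rewrite -?exh -?exl;
  exact/near_tauC/balanced_pair_near.
have isE x y c : x \in W -> y \in U -> (outn U x)%:Z = c -> (outn W y)%:Z = c ->
    (x, y) \in edges G.
  by move=> xW yU ex ey; apply: (balanced_pair_edge bal) => //; case: (etrans ex (esym ey)).
have isA x y c : x \in W -> y \in U -> (outn U x)%:Z = c + tau ->
    (outn W y)%:Z = c -> (x, y) \in dir_arcs G.
  by move=> xW yU ex ey; apply: (balanced_pair_dir bal) => //; rewrite ex ey.
have isA' x y c : x \in W -> y \in U -> (outn U x)%:Z = c ->
    (outn W y)%:Z = c + tau -> (y, x) \in dir_arcs G.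
  move=> xW yU ex ey; apply: (balanced_pair_dir (balanced_pair_sym bal)) => //.
  by rewrite ex ey.
(* A vertex of level [s] sends no arc across, so its out-count [s] is 0. *)
have s0 : s = 0.
  rewrite -exl /outn card_setId_none // => y yU.
  case: (Uval _ yU) => ey; last exact/dir_arcs_asym/(isA' _ _ _ xlW yU exl ey).
  exact: (edges_notin_dir (isE _ _ _ xlW yU exl ey)).1.
(* Both count the vertices of level [s] in [U]. *)
have edl : edgen U xl = outn U xh.
  congr #|pred_of_set _|; apply/setP=> y; rewrite [LHS]in_set [RHS]in_set.
  case yU: (y \in U) => //=; case: (Uval _ yU) => ey.
    by rewrite (isE _ _ _ xlW yU exl ey) (isA _ _ _ xhW yU exh ey).
  have h1 := isA' _ _ _ xlW yU exl ey; have h2 := isE _ _ _ xhW yU exh ey.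
  rewrite (negPf (edges_notin_dir h2).1); apply/negbTE/negP => h3.
  by have := (edges_notin_dir h3).2; rewrite h1.
(* Edge counts agree across the pair, so comparison with [yl] makes them constant on [W]. *)
have edh : edgen U xh = edgen U xl by rewrite (ed xh yl) // (ed xl yl).
split.
  (* [xh] receives no arc from [U], so [r] is its out-count plus its edge count, each equal to
     [tau]. *)
  have := card_adj_split (fun y => adj xh y xhW).
  rewrite cU edh edl [X in (_ + X)%N]card_setId_none.
    by move=> ->; move: exh; rewrite s0 add0r addn0 PoszD => ->.
  move=> y yU; case: (Uval _ yU) => ey.
    exact/dir_arcs_asym/(isA _ _ _ xhW yU exh ey).
  exact: (edges_notin_dir (isE _ _ _ xhW yU exh ey)).2.
exists [set x in W | (outn U x)%:Z == s + tau], [set x in W | (outn U x)%:Z == s].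
exists [set y in U | (outn W y)%:Z == s + tau], [set y in U | (outn W y)%:Z == s].
have part (S : {set G}) (f : G -> nat) (zl zh : G) : zl \in S -> zh \in S ->
    (f zl)%:Z = s -> (f zh)%:Z = s + tau ->
    (forall z, z \in S -> (f z)%:Z = s \/ (f z)%:Z = s + tau) ->
    two_partition S [set z in S | (f z)%:Z == s + tau] [set z in S | (f z)%:Z == s].
  move=> zlS zhS fl fh fS; split.
  - by apply/set0Pn; exists zh; rewrite inE zhS fh eqxx.
  - by apply/set0Pn; exists zl; rewrite inE zlS fl eqxx.
  - rewrite -setI_eq0; apply/eqP/setP=> z; rewrite !inE.
    apply/negbTE/negP => /andP[/andP[_ /eqP h1] /andP[_ /eqP h2]].
    by move: tau_neq0; rewrite -(addKr s tau) -h1 h2 addNr eqxx.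
  - apply/setP=> z; rewrite !inE; case zS: (z \in S) => //=.
    by case: (fS _ zS) => ->; rewrite eqxx ?orbT.
split.
- exact: part xlW xhW exl exh Wval.
- exact: part ylU yhU eyl eyh Uval.
- rewrite subUset; apply/andP; split; apply: setX_subP => x y;
  rewrite [_ \in finset _]in_set => /andP[xW /eqP ex];
  rewrite [_ \in finset _]in_set => /andP[yU /eqP ey]; exact: (isE _ _ _ xW yU ex ey).
- rewrite subUset; apply/andP; split; apply: setX_subP => x y;
  rewrite [_ \in finset _]in_set => /andP[xW /eqP ex];
  rewrite [_ \in finset _]in_set => /andP[yU /eqP ey].
    exact: (isA _ _ _ xW yU ex ey).
  exact: (isA' _ _ _ yU xW ey ex).
Qed.

Lemma balanced_pair_classified W U : balanced_pair W U -> pair_classified W U.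
Proof.
move=> bal; case: (bal) => cW cU _ _ _.
have const_or (S : {set G}) (f : G -> nat) : #|S| = r -> (exists s, forall z, z \in S -> f z = s) \/
    exists z1 z2, [/\ z1 \in S, z2 \in S & f z1 != f z2].
  move=> cS; have [z0 z0S] : exists z, z \in S.
    by apply/set0Pn; rewrite -cards_eq0 cS -lt0n.
  have [/existsP[z /andP[zS nz]]|no] := boolP [exists z, (z \in S) && (f z0 != f z)].
    by right; exists z0, z.
  left; exists (f z0) => z zS; apply/eqP; apply: contraNT no => nz.
  by apply/existsP; exists z; rewrite zS eq_sym.
have [[s cst]|[x1 [x2 [x1W x2W nx]]]] := const_or W (outn U) cW.
  exact: balanced_pair_const cst.
have [[s cst]|[y1 [y2 [y1U y2U ny]]]] := const_or U (outn W) cU; last first.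
  have [? ?] := balanced_pair_nonconst bal x1W x2W y1U y2U nx ny.
  by constructor 3; split=> //; constructor 3.
(* The out-counts are constant on [U], so the reversed pair is classified and each alternative is
   mirrored back. *)
case: (balanced_pair_const (balanced_pair_sym bal) cst).
- move=> sub; constructor 1; apply: setX_subP => x y xW yU.
  by rewrite edges_sym; apply: (subsetP sub); rewrite inE yU.
- by case=> ? [] ?; constructor 2; split=> //; [right | left].
- case=> ? [] b; constructor 3; split=> //; [by constructor 2 | by constructor 1 |].
  case: b => U1 [U2 [W1 [W2 [pU pW ee aa]]]]; constructor 3.
  exists W1, W2, U1, U2; split=> //.
    move: ee; rewrite !subUset => /andP[e1 e2]; apply/andP; split;
    apply: setX_subP => x y xS yS; rewrite edges_sym;
    by [apply: (subsetP e1); rewrite inE yS | apply: (subsetP e2); rewrite inE yS].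
  by rewrite setUC.
Qed.

End Pair.

(** * From pairs of partite sets to the three types *)

Section Team.
Variables (m r : nat) (G : digraph) (V : 'I_m -> {set G}).
Hypothesis team : team_semicomplete_multipartite r V.
Implicit Types (x y z : G) (i j : 'I_m).

Let sameC : 'M[int]_#|G| :=
  const_mx 1 - adj_mx (dir_arcs G) - (adj_mx (dir_arcs G))^T - adj_mx (edges G).

Lemma part_of x : exists i, x \in V i.
Proof. by case: team => _ _ /(_ x)[i [xi _]] _; exists i. Qed.

Lemma part_uniq x i j : x \in V i -> x \in V j -> i = j.
Proof.
by case: team => _ _ /(_ x)[k [_ ku]] _ /ku <- /ku <-.
Qed.

Lemma same_part_indicator z y j : y \in V j ->
  1 - ((z, y) \in dir_arcs G)%:R - ((y, z) \in dir_arcs G)%:R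
    - ((z, y) \in edges G)%:R = (z \in V j)%:R :> int.
Proof.
move=> yj; have [i zi] := part_of z.
have -> : (z \in V j) = (i == j).
  by apply/idP/eqP => [/(part_uniq zi) //|<-].
case: team => _ _ _ /(_ _ _ _ _ zi yj).
move=> adj_zy; rewrite -[i == j]negbK -adj_zy /underlying_adj /= !in_dir_arcs in_edges.
by do 2 case: (_ \in arcs G).
Qed.

Lemma adj_mx_same_part (R : {set G * G}) x y j : y \in V j ->
  (adj_mx R *m sameC) (enum_rank x) (enum_rank y) =
  #|[set z in V j | (x, z) \in R]|%:R.
Proof.
move=> yj; rewrite -sum_indicator -sum_enum_val mxE; apply: eq_bigr => c _.
rewrite !mxE !enum_rankK (same_part_indicator _ yj).
by do 2 case: (_ \in _).
Qed.

Lemma same_part_adj_mx (R : {set G * G}) x y i : x \in V i ->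
  (sameC *m (adj_mx R)^T) (enum_rank x) (enum_rank y) =
  #|[set z in V i | (y, z) \in R]|%:R.
Proof.
move=> xi; have symC : sameC = sameC^T.
  by apply/matrixP=> a b; rewrite !mxE (edges_sym (enum_val b)); ring.
by rewrite symC -trmx_mul mxE (adj_mx_same_part _ _ xi).
Qed.

Lemma doubly_regular_balanced_pair p i j : doubly_regular G p -> i != j ->
  balanced_pair (type_number p) r (V i) (V j).
Proof.
move=> dreg ij; have [EC AC] := doubly_regular_mx dreg.
case: (team) => _ cV _ adj; split=> // x y xi yj.
- by rewrite (adj i j).
- have /matrixP/(_ (enum_rank x) (enum_rank y)) := AC.
  rewrite [LHS]mxE [(- _ : 'M__) _ _]mxE (adj_mx_same_part _ _ yj).
  rewrite (same_part_adj_mx _ _ xi) !natz => ->.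
  by rewrite !mxE !enum_rankK !natz.
- have /matrixP/(_ (enum_rank x) (enum_rank y)) := EC.
  (* The edge matrix on the right-hand side is written as its own transpose, the form in which the
     entry counts edges at [y]. *)
  rewrite (adj_mx_same_part _ _ yj) -{2}tr_edges_mx (same_part_adj_mx _ _ xi).
  by rewrite !natz => -[].
Qed.

Lemma part_point i : exists x, x \in V i.
Proof.
case: team => -[_ r2] cV _ _.
by apply/set0Pn; rewrite -cards_eq0 cV; case: r r2.
Qed.

(** Counts at [x] and [y] in different parts agree, so each is constant on its part and symmetric in
    the two indices; double counting then gives [r = c + e + c]. *)
Lemma typeII_of_type_number0 p : doubly_regular G p -> type_number p = 0 ->
  typeII r V p.
Proof.
move=> dreg t0; split=> //.
pose pt i := xchoose (part_point i).
have ptP i : pt i \in V i := xchooseP (part_point i).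
have bal i j : i != j -> balanced_pair 0 r (V i) (V j).
  by rewrite -t0; apply: doubly_regular_balanced_pair.
have outE i j x y : i != j -> x \in V i -> y \in V j -> outn (V j) x = outn (V i) y.
  move=> /bal[_ _ _ h _] xi yj; have /eqP := h _ _ xi yj.
  by rewrite mul0r subr_eq0 => /eqP[].
have edE i j x y : i != j -> x \in V i -> y \in V j -> edgen (V j) x = edgen (V i) y.
  by move=> /bal[_ _ _ _ h]; apply: h.
exists (fun i j => outn (V j) (pt i)), (fun i j => edgen (V j) (pt i)).
move=> i j ij; have oc x : x \in V i -> outn (V j) x = outn (V j) (pt i).
  by move=> xi; rewrite !(@outE i j _ (pt j)).
have ec x : x \in V i -> edgen (V j) x = edgen (V j) (pt i).
  by move=> xi; rewrite !(@edE i j _ (pt j)).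
split=> //; first exact: outE.
have [ci cj adj _ _] := bal _ _ ij.
have r_gt0 : (0 < r)%N by case: team => -[_ /ltnW].
set c := outn _ _; set e := edgen _ _.
(* The split of [V j] seen from [x] is summed over [V i]; the last term counts the arcs from [V j]
   to [V i] at their tails. *)
have tot : (r * r = r * c + r * e + r * c)%N.
  have := dir_arcs_double_count (V i) (V j).
  rewrite [RHS](eq_bigr (fun=> c)); last first.
    by move=> y yj; rewrite -(outE i j (pt i) y).
  rewrite sum_nat_const cj => {2}<-.
  rewrite -{2}cj -ci -!sum_nat_const -!big_split /=.
  apply: eq_bigr => x xi; rewrite (card_adj_split (adj x ^~ xi)).
  by rewrite oc // ec.
have {tot} : (r = c + e + c)%N.
  by apply/eqP; rewrite -(eqn_pmul2l r_gt0) tot !mulnDr.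
by move=> ->; rewrite !natrD; field.
Qed.

(** The quotient has the part indices as vertices, with arcs read off representatives. The
    isomorphism sends a vertex to its part and its position in the enumeration of that part. *)
Lemma uniform_coclique_extension :
    (forall i j, i != j -> [\/ setX (V i) (V j) \subset edges G,
       setX (V i) (V j) \subset dir_arcs G | setX (V j) (V i) \subset dir_arcs G]) ->
  exists2 S : digraph, semicomplete S & coclique_extension r G S.
Proof.
move=> uni.
have uniA i j x y x' y' : i != j -> x \in V i -> x' \in V i -> y \in V j -> y' \in V j ->
    ((x, y) \in arcs G) = ((x', y') \in arcs G).
  move=> ij xi xi' yj yj'.
  have inX W U (R : {set G * G}) u v : setX W U \subset R -> u \in W -> v \in U ->
      (u, v) \in R by move=> /subsetP sub uW vU; apply: sub; rewrite inE uW.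
  case: (uni _ _ ij) => sub.
  - have := inX _ _ _ _ _ sub xi yj; have := inX _ _ _ _ _ sub xi' yj'.
    by rewrite !in_edges => /andP[-> _] /andP[-> _].
  - have := inX _ _ _ _ _ sub xi yj; have := inX _ _ _ _ _ sub xi' yj'.
    by rewrite !in_dir_arcs => /andP[-> _] /andP[-> _].
  - have := inX _ _ _ _ _ sub yj xi; have := inX _ _ _ _ _ sub yj' xi'.
    by rewrite !in_dir_arcs => /andP[_ /negPf->] /andP[_ /negPf->].
case: (team) => -[_ r2] cV _ adj.
pose pt i := xchoose (part_point i).
have ptP i : pt i \in V i := xchooseP (part_point i).
have noloop i : (i, i) \notin [set q : 'I_m * 'I_m | (pt q.1, pt q.2) \in arcs G].
  by rewrite inE arcs_loopless.
pose S := Digraph noloop; exists S.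
  move=> i j ij; have := adj _ _ _ _ (ptP i) (ptP j).
  by rewrite ij /underlying_adj /= !inE.
pose pa x := xchoose (part_of x).
have paP x : x \in V (pa x) := xchooseP (part_of x).
have idx_lt x : (index x (enum (V (pa x))) < r)%N.
  by rewrite -(cV (pa x)) cardE index_mem mem_enum.
pose f x : lex_product S (arcless r) := (pa x, Ordinal (idx_lt x)).
pose g (q : lex_product S (arcless r)) : G := nth (pt q.1) (enum (V q.1)) q.2.
have gV q : g q \in V q.1.
  by rewrite -mem_enum mem_nth // -cardE cV; exact: (ltn_ord q.2).
exists f.
  exists g => [x|q]; first by rewrite /g /f /= nth_index // mem_enum.
  have paq : pa (g q) = q.1 by apply: part_uniq (paP _) (gV q).
  (* The bound proof inside [Ordinal] depends on [pa (g q)], so it is generalized before the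
     rewriting. *)
  rewrite /f; move: (idx_lt _); rewrite paq => lt.
  case: q {gV paq} lt => i k lt; congr pair; apply: val_inj => /=.
  by rewrite /g /= index_uniq ?enum_uniq // -cardE cV; exact: (ltn_ord k).
move=> x y; rewrite !inE /= andbF orbF.
have [eqp|np] := eqVneq (pa x) (pa y); last by apply: (uniA _ _ _ _ _ _ np).
rewrite eqp (negPf (arcs_loopless _)).
have := adj _ _ _ _ (paP x) (paP y).
by rewrite eqp eqxx /underlying_adj /=; case: (_ \in _).
Qed.

(** For nonzero type number, the pair of parts joined by a non-symmetric arc is not all edges, so it
    fixes the type number as [r] or half of [r]. As [r] is positive, no other pair can then realize
    the other value. *)
Lemma dir_arcs_one_of_three_types p : doubly_regular G p ->
  dir_arcs G != set0 -> one_of_three_types r V p.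
Proof.
move=> dreg /set0Pn[[x y] xy]; have [t0|tn0] := eqVneq (type_number p) 0.
  by constructor 2; apply: typeII_of_type_number0.
have r_gt0 : (0 < r)%N by case: team => -[_ /ltnW].
have cls i j (ij : i != j) := balanced_pair_classified r_gt0 tn0
  (doubly_regular_balanced_pair dreg ij).
have [i xi] := part_of x; have [j yj] := part_of y.
have ij : i != j.
  case: team => _ _ _ /(_ _ _ _ _ xi yj) <-.
  by move: xy; rewrite in_dir_arcs /underlying_adj /= => /andP[->].
case: (cls _ _ ij) => [sub|[tr _]|[tr _]].
- have /edges_notin_dir[] : (x, y) \in edges G.
    by apply: (subsetP sub); rewrite inE xi yj.
  by rewrite xy.
- constructor 1; split=> //; apply: uniform_coclique_extension => i' j' ij'.
  case: (cls _ _ ij') => [sub|[_ [] sub]|[tr2 _]];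
    [by constructor 1 | by constructor 2 | by constructor 3 |].
  by clear -tr tr2 r_gt0; lia.
- constructor 3; split=> [|i' j' ij'].
    have -> : r%:R = (r%:Z)%:~R :> rat by [].
    by rewrite -tr rmorphMn /= -[_ *+ 2]mulr_natr mulfK.
  case: (cls _ _ ij') => [sub|[tr2 _]|[_ []]]; first by constructor 1.
  + by clear -tr tr2 r_gt0; lia.
  + by constructor 2; left.
  + by constructor 2; right.
  + by constructor 3.
Qed.

End Team.

(* If G has a non-symmetric arc, then alpha and beta are determined by G and
   the classification holds for the given parameters.  If G has none, then
   alpha and beta are arbitrary in the defining identities, and the
   classification holds for a suitable choice of parameters. *)
Theorem theorem3p9 (m r : nat) (G : digraph) (V : 'I_m -> {set G}) (p : params) :
  team_semicomplete_multipartite r V ->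
  doubly_regular G p ->
  (dir_arcs G != set0 -> one_of_three_types r V p) /\
  (exists q : params, doubly_regular G q /\ one_of_three_types r V q).
Proof.
move=> team dreg; have types := dir_arcs_one_of_three_types team dreg.
split=> //; have [A0|nA0] := eqVneq (dir_arcs G) set0; last first.
  by exists p; split=> //; apply: types.
(* The matrix of non-symmetric arcs is 0, so its coefficients may be replaced by 0; the type number
   becomes 0, which is type II. *)
pose q := Params (par_t p) (fun=> 0) (fun=> 0) (gamma p) (eta p).
have dregq : doubly_regular G q.
  case: dreg => reg eqs; split=> // i j.
  have A1 : adj_mx (dir_arcs G) = 0 by apply/matrixP=> a b; rewrite !mxE A0 inE.
  by rewrite eqs /= A1 trmx0 !scaler0.
exists q; split=> //; constructor 2; exact: typeII_of_type_number0.
Qed.
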